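(* Let $\ell,m,n$ be positive integers. The degree $\ell mn$ of the invariant $F_{(\ell,m,n)}$ is minimal among all generic invariants of $\mathbb{C}^{\ell m}\otimes\mathbb{C}^{mn}\otimes\mathbb{C}^{n\ell}$; that is, if $d>0$ and there is a nonzero homogeneous polynomial of degree $d$ on $\mathbb{C}^{\ell m}\otimes\mathbb{C}^{mn}\otimes\mathbb{C}^{n\ell}$ that is invariant under $\operatorname{SL}_{\ell m}(\mathbb{C})\times\operatorname{SL}_{mn}(\mathbb{C})\times\operatorname{SL}_{n\ell}(\mathbb{C})$, then $d\ge \ell mn$, and the value $d=\ell mn$ is attained.
   Context: The group $\operatorname{SL}_{\ell m}\times\operatorname{SL}_{mn}\times\operatorname{SL}_{n\ell}$ acts on $\mathbb{C}^{\ell m}\otimes\mathbb{C}^{mn}\otimes\mathbb{C}^{n\ell}$ factorwise. $F_{(\ell,m,n)}$ denotes a (unique up to scalar) nonzero invariant homogeneous polynomial of degree $\ell mn$ on this space, whose existence and uniqueness correspond to the Kronecker coefficient equality $k(\ell m\times n,\,mn\times\ell,\,n\ell\times m)=1$, where $a\times b$ denotes the partition $(b,\dots,b)$ with $a$ parts. *)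

(* Defs.v *)
From HB Require Import structures.
From mathcomp Require Import all_boot all_order all_algebra.
From mathcomp Require Import complex reals mpoly.

Set Implicit Arguments.
Unset Strict Implicit.
Unset Printing Implicit Defensive.

Import GRing.Theory.
Local Open Scope ring_scope.

Section Tensors.
Variables (K : fieldType) (a b c : nat).

(* K^a (x) K^b (x) K^c in coordinates with respect to the basis
   e_i (x) e_j (x) e_k. *)
Definition tensor := {ffun 'I_a * 'I_b * 'I_c -> K}.

(* (A (x) B (x) C) t, each matrix acting on column vectors: A e_i' is the
   i'-th column of A. *)
Definition tensor_act (A : 'M[K]_a) (B : 'M[K]_b) (C : 'M[K]_c) (t : tensor) :
    tensor :=
  [ffun x : 'I_a * 'I_b * 'I_c =>
     \sum_(i < a) \sum_(j < b) \sum_(k < c)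
       A x.1.1 i * B x.1.2 j * C x.2 k * t (i, j, k)].

(* One variable per coordinate; mpoly variables are indexed by ordinals, so
   the triple of indices y corresponds to the variable 'X_(enum_rank y). *)
Definition tensor_poly := {mpoly K[#|{: 'I_a * 'I_b * 'I_c}|]}.

Definition tensor_eval (F : tensor_poly) (t : tensor) : K :=
  F.@[fun x => t (enum_val x)].

Definition SL_invariant (F : tensor_poly) : Prop :=
  forall (A : 'M[K]_a) (B : 'M[K]_b) (C : 'M[K]_c),
    \det A = 1 -> \det B = 1 -> \det C = 1 ->
    forall t : tensor, tensor_eval F (tensor_act A B C t) = tensor_eval F t.

Definition nonzero_invariant_of_degree (d : nat) (F : tensor_poly) : Prop :=
  [/\ F != 0, F \is d.-homog & SL_invariant F].

End Tensors.

Arguments tensor_poly : clear implicits.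

(* Main.v *)
Require Import Defs.
From HB Require Import structures.
From mathcomp Require Import all_boot all_order all_algebra.
From mathcomp Require Import all_fingroup.
From mathcomp Require Import complex reals mpoly.
From mathcomp Require Import zify ring.

(** Write a, b, c for lm, mn, nl.  A form of degree d on K^a (x) K^b (x) K^c is
    the same as a symmetric tensor f (I, J, k), where I : [d] -> [a],
    J : [d] -> [b] and k : [d] -> [c] are functions of a position in
    [d] = {0, ..., d - 1}, and the form is invariant exactly when f is invariant
    in each of its three arguments separately ([SL_invariant_form_poly]).  So
    the question is about SL_N-invariants in the d-th tensor power of K^N.

    The classical source of such invariants is the bracket: given a labelling V
    of the positions by d / N labels, multiply the N x N determinants of the
    vectors sitting at equally labelled positions.  The first fundamental
    theorem says that these products span the invariants.  It is used here in
    the dual form [bracket_separates]: an invariant that is orthogonal to all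
    brackets vanishes.  The proof polarizes the identity h (A x ... x A) =
    (det A)^k h, evaluates it at elementary matrices, and concludes by a sum of
    squares.

    Lower bound ([invariant_degree_bound]).  If f is a nonzero invariant, apply
    the separation in each argument: for some labellings V1, V2, V3 by
    k1 = d / a, k2 = d / b, k3 = d / c labels, the pairing of f with the product
    of the three brackets is nonzero.  If two positions carried the same triple
    of labels, exchanging them would fix f and change the sign of each of the
    three brackets, so that the pairing would be its own opposite.  Hence
    positions have distinct triples of labels, d <= k1 k2 k3 = d^3 / (abc), and
    (lmn)^2 = abc <= d^2.

    Attainment ([cube_tensor_neq0]).  For d = lmn the label sets have n, l, m
    elements and the three labellings identify [d] with the cube
    [n] x [l] x [m].  Summing the product of the three brackets over all such
    identifications, with the sign of the identification, gives a symmetric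
    invariant tensor.  A bracket is also an invariant of its labels, so the
    signs of the identifications form an invariant in each of the three
    labellings; separation, used once for each labelling, shows that the sum
    can vanish only if all these signs vanish, which is absurd.  This
    exchange of labels and indices is the identity
    k(lambda, mu, nu) = k(lambda', mu', nu) of Kronecker coefficients made
    explicit.  *)

Set Implicit Arguments.
Unset Strict Implicit.
Unset Printing Implicit Defensive.

Import GRing.Theory Num.Theory.
Local Open Scope ring_scope.

(** * Index maps on d positions *)

Definition permute (T : finType) d (x : {ffun 'I_d -> T}) (s : 'S_d) :
  {ffun 'I_d -> T} := [ffun r => x (s r)].

Definition join (T1 T2 : finType) d (x : {ffun 'I_d -> T1})
  (y : {ffun 'I_d -> T2}) : {ffun 'I_d -> T1 * T2} := [ffun r => (x r, y r)].

Definition lpart (T1 T2 : finType) d (z : {ffun 'I_d -> T1 * T2}) :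
  {ffun 'I_d -> T1} := [ffun r => (z r).1].
Definition rpart (T1 T2 : finType) d (z : {ffun 'I_d -> T1 * T2}) :
  {ffun 'I_d -> T2} := [ffun r => (z r).2].

Section Permute.
Variables (T T1 T2 : finType) (d : nat).
Implicit Types (s t : 'S_d).

Lemma permuteK s : cancel (@permute T d ^~ s) (@permute T d ^~ s^-1%g).
Proof. by move=> x; apply/ffunP=> r; rewrite !ffunE permKV. Qed.

Lemma permuteKV s : cancel (@permute T d ^~ s^-1%g) (@permute T d ^~ s).
Proof. by move=> x; apply/ffunP=> r; rewrite !ffunE permK. Qed.

Lemma permute1 (x : {ffun 'I_d -> T}) : permute x 1%g = x.
Proof. by apply/ffunP=> r; rewrite !ffunE perm1. Qed.

Lemma permuteM (x : {ffun 'I_d -> T}) s t :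
  permute (permute x s) t = permute x (t * s)%g.
Proof. by apply/ffunP=> r; rewrite !ffunE permM. Qed.

Lemma permute_join (x : {ffun 'I_d -> T1}) (y : {ffun 'I_d -> T2}) s :
  permute (join x y) s = join (permute x s) (permute y s).
Proof. by apply/ffunP=> r; rewrite !ffunE. Qed.

Lemma sum_permute (K : nmodType) s (F : {ffun 'I_d -> T} -> K) :
  \sum_x F x = \sum_x F (permute x s).
Proof. by apply: reindex; exists (@permute T d ^~ s^-1%g) => x _;
  [exact: permuteK|exact: permuteKV]. Qed.

End Permute.

Lemma joinK (T1 T2 : finType) d (z : {ffun 'I_d -> T1 * T2}) :
  join (lpart z) (rpart z) = z.
Proof. by apply/ffunP=> r; rewrite !ffunE -surjective_pairing. Qed.

Lemma lpart_join (T1 T2 : finType) d (x : {ffun 'I_d -> T1})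
  (y : {ffun 'I_d -> T2}) : lpart (join x y) = x.
Proof. by apply/ffunP=> r; rewrite !ffunE. Qed.

Lemma rpart_join (T1 T2 : finType) d (x : {ffun 'I_d -> T1})
  (y : {ffun 'I_d -> T2}) : rpart (join x y) = y.
Proof. by apply/ffunP=> r; rewrite !ffunE. Qed.

Lemma lpart_permute (T1 T2 : finType) d (z : {ffun 'I_d -> T1 * T2}) s :
  lpart (permute z s) = permute (lpart z) s.
Proof. by apply/ffunP=> r; rewrite !ffunE. Qed.

Lemma rpart_permute (T1 T2 : finType) d (z : {ffun 'I_d -> T1 * T2}) s :
  rpart (permute z s) = permute (rpart z) s.
Proof. by apply/ffunP=> r; rewrite !ffunE. Qed.

Lemma sum_join (K : nmodType) (T1 T2 : finType) d
    (F : {ffun 'I_d -> T1 * T2} -> K) :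
  \sum_z F z = \sum_x \sum_y F (join x y).
Proof.
rewrite pair_big /=.
apply: (reindex (fun p : {ffun 'I_d -> T1} * {ffun 'I_d -> T2} => join p.1 p.2)).
exists (fun z => (lpart z, rpart z)) => [[x y]|z] _ /=.
  by rewrite lpart_join rpart_join.
exact: joinK.
Qed.

Lemma bij_of_card (T : finType) d :
  #|T| = d -> exists e : 'I_d -> T, bijective e.
Proof. by move=> <-; exists enum_val; exact: enum_val_bij. Qed.

(** * Linear substitution in coefficient tensors *)

(** The coefficient tensor of the multilinear form with coefficients h after the
    linear substitution g has been made in each of its d vector arguments; see
    [form_linear]. *)
Definition pullback (K : pzSemiRingType) (T : finType) d (g : T -> T -> K)
    (h : {ffun 'I_d -> T} -> K) : {ffun 'I_d -> T} -> K :=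
  fun x => \sum_y h y * \prod_s g (y s) (x s).

Definition kron (K : pzSemiRingType) (T1 T2 : Type) (g1 : T1 -> T1 -> K)
    (g2 : T2 -> T2 -> K) : T1 * T2 -> T1 * T2 -> K :=
  fun i j => g1 i.1 j.1 * g2 i.2 j.2.

Definition kron3 (K : pzSemiRingType) a b c (A : 'M[K]_a) (B : 'M[K]_b)
    (C : 'M[K]_c) :=
  kron (kron (fun i j => A i j) (fun i j => B i j)) (fun i j => C i j).

Section PullbackMatrix.
Variables (K : comPzRingType) (T : finType) (d : nat).
Implicit Types (g : T -> T -> K) (h : {ffun 'I_d -> T} -> K).

Lemma eq_pullback g1 g2 h x : g1 =2 g2 -> pullback g1 h x = pullback g2 h x.
Proof.
by move=> g12; apply: eq_bigr => y _; congr (_ * _); apply: eq_bigr => r _.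
Qed.

Lemma pullback_pullback g1 g2 h x :
  pullback g2 (pullback g1 h) x =
  pullback (fun i j => \sum_k g1 i k * g2 k j) h x.
Proof.
rewrite /pullback; under eq_bigr do rewrite mulr_suml.
rewrite exchange_big; apply: eq_bigr => y _ /=.
rewrite bigA_distr_bigA mulr_sumr; apply: eq_bigr => z _ /=.
by rewrite -mulrA -big_split.
Qed.

Lemma pullback_scale a g h x :
  pullback (fun i j => a * g i j) h x = a ^+ d * pullback g h x.
Proof.
rewrite /pullback mulr_sumr; apply: eq_bigr => y _.
by rewrite big_split prodr_const card_ord mulrCA.
Qed.

Lemma pullback_diag (w : T -> K) h x :
  pullback (fun i j => w i *+ (i == j)) h x = h x * \prod_r w (x r).
Proof.
rewrite /pullback (bigD1 x) //= [X in _ + X]big1 ?addr0 => [|y yx].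
  by congr (_ * _); apply: eq_bigr => r _; rewrite eqxx.
have [r yxr] : exists r, y r != x r.
  apply/existsP; rewrite -negb_forall; apply: contra yx => /forallP yx.
  by apply/eqP/ffunP => r; apply/eqP.
by rewrite (bigD1 r) //= (negbTE yxr) mulr0n mul0r mulr0.
Qed.

End PullbackMatrix.

Section PullbackTensor.
Variables (K : comPzRingType) (d : nat).

Lemma eq_pullback_tensor (T : finType) g (h1 h2 : {ffun 'I_d -> T} -> K) x :
  h1 =1 h2 -> pullback g h1 x = pullback g h2 x.
Proof. by move=> h12; apply: eq_bigr => y _; rewrite h12. Qed.

Lemma pullback_sum (T I : finType) g (h : I -> {ffun 'I_d -> T} -> K) x :
  pullback g (fun y => \sum_i h i y) x = \sum_i pullback g (h i) x.
Proof. by rewrite exchange_big; apply: eq_bigr => y _; rewrite mulr_suml. Qed.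

Lemma pullback_mulr (T : finType) g (h : {ffun 'I_d -> T} -> K) c x :
  pullback g (fun y => h y * c) x = pullback g h x * c.
Proof.
by rewrite /pullback mulr_suml; apply: eq_bigr => y _; rewrite mulrAC.
Qed.

Lemma pullback_mull (T : finType) g (h : {ffun 'I_d -> T} -> K) c x :
  pullback g (fun y => c * h y) x = c * pullback g h x.
Proof.
by rewrite /pullback mulr_sumr; apply: eq_bigr => y _; rewrite mulrA.
Qed.

Lemma pullback_kron (T1 T2 : finType) g1 g2
    (h : {ffun 'I_d -> T1 * T2} -> K) x y :
  pullback (kron g1 g2) h (join x y) =
  pullback g1 (fun x' => pullback g2 (fun y' => h (join x' y')) y) x.
Proof.
rewrite /pullback sum_join; apply: eq_bigr => x' _.
rewrite mulr_suml; apply: eq_bigr => y' _; rewrite mulrAC -mulrA -big_split /=.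
by congr (_ * _); apply: eq_bigr => r _; rewrite !ffunE.
Qed.

Lemma pullback_delta (T : finType) (h : {ffun 'I_d -> T} -> K) x :
  pullback (fun i j => (i == j)%:R) h x = h x.
Proof. by rewrite (pullback_diag (fun=> 1)) big1 ?mulr1. Qed.

Lemma pullback_symmetric (T : finType) g (h : {ffun 'I_d -> T} -> K) :
  (forall x s, h (permute x s) = h x) ->
  forall x s, pullback g h (permute x s) = pullback g h x.
Proof.
move=> h_sym x s; rewrite /pullback [LHS](sum_permute s); apply: eq_bigr => y _.
rewrite h_sym; congr (_ * _); rewrite [RHS](reindex_perm s) /=.
by apply: eq_bigr => r _; rewrite !ffunE.
Qed.

Lemma pullback_one N (h : {ffun 'I_d -> 'I_N} -> K) x :
  pullback (fun i j => (1%:M : 'M[K]_N) i j) h x = h x.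
Proof.
by rewrite -[RHS]pullback_delta; apply: eq_pullback => i j; rewrite mxE.
Qed.

End PullbackTensor.

(** * Brackets *)

(** For T = L * 'I_N and e a bijection, z gives each position a label and an
    index.  When the labels split the positions into blocks of size N, this is,
    up to a sign depending on the labels alone, the product over the blocks of
    the Levi-Civita symbols of the indices; otherwise it is 0.  It is written as
    one d x d determinant, so that no order has to be chosen within the blocks
    and labels and indices play symmetric parts. *)
Definition bracket (K : comPzRingType) (T : finType) d (e : 'I_d -> T)
  (z : {ffun 'I_d -> T}) : K := \det (\matrix_(r, p) (z r == e p)%:R).

Section Bracket.
Variable K : comPzRingType.

Lemma bracket_permute (T : finType) d (e : 'I_d -> T) z (s : 'S_d) :
  bracket K e (permute z s) = (-1) ^+ s * bracket K e z.
Proof.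
rewrite /bracket -det_perm -det_mulmx -row_permE; congr (\det _).
by apply/matrixP=> r p; rewrite !mxE ffunE.
Qed.

Lemma bracket_id (T : finType) d (e : 'I_d -> T) : injective e ->
  bracket K e (finfun e) = 1.
Proof.
move=> e_inj; rewrite -(det1 K d); congr (\det _).
by apply/matrixP=> r p; rewrite !mxE ffunE (inj_eq e_inj).
Qed.

Lemma bracket_comp (T T' : finType) d (f : T -> T') (e : 'I_d -> T)
    (z : {ffun 'I_d -> T}) :
  injective f -> bracket K (f \o e) [ffun r => f (z r)] = bracket K e z.
Proof.
move=> f_inj; congr (\det _); apply/matrixP=> r p.
by rewrite !mxE ffunE (inj_eq f_inj).
Qed.

(** Both matrices represent M on the basis T; the change of enumeration
    conjugates by a permutation matrix, whose sign occurs twice. *)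
Lemma det_reindex (T : finType) d (e e' : 'I_d -> T) (M : T -> T -> K) :
  bijective e -> bijective e' ->
  \det (\matrix_(q, p) M (e q) (e p)) = \det (\matrix_(q, p) M (e' q) (e' p)).
Proof.
move=> e_bij [f' e'K f'K].
have s_inj : injective (f' \o e).
  by apply: inj_comp; [exact: can_inj f'K | exact: bij_inj].
set s := perm s_inj; set N := \matrix_(q, p) M (e' q) (e' p).
have -> : \matrix_(q, p) M (e q) (e p) = row_perm s (col_perm s N).
  by apply/matrixP=> q p; rewrite !mxE !permE /= !f'K.
rewrite row_permE col_permE !det_mulmx !det_perm odd_permV mulrCA.
by rewrite -signr_addb addbb mulr1.
Qed.

(** The matrix is the transpose of 1 (x) A, made of #|L| diagonal copies of A.
    An enumeration of 'I_k * 'I_N that runs through the copies one after the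
    other makes it block diagonal, and [det_reindex] allows any other. *)
Lemma det_block_copies (L : finType) d N (e : 'I_d -> L * 'I_N) (A : 'M[K]_N) :
  bijective e ->
  \det (\matrix_(q, p) (((e q).1 == (e p).1)%:R * A (e p).2 (e q).2)) =
  \det A ^+ #|L|.
Proof.
have [e0 [e0_inj e0_det]] : exists e0 : 'I_(#|L| * N) -> 'I_#|L| * 'I_N,
  injective e0 /\
  \det (\matrix_(q, p) (((e0 q).1 == (e0 p).1)%:R * A (e0 p).2 (e0 q).2)) =
  \det A ^+ #|L|.
  elim: #|L| => [|k [e0 [e0_inj e0_det]]].
    exists (fun p : 'I_0 =>
      match p with Ordinal _ i0 => False_rect _ (notF i0) end).
    by split=> [[]|]; rewrite ?det_mx00.
  exists (fun p : 'I_(N + k * N) => match split p with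
     inl j => (ord0, j) | inr q => (lift ord0 (e0 q).1, (e0 q).2) end).
  split.
    move=> p1 p2; rewrite -[p1]splitK -[p2]splitK !unsplitK.
    case: (split p1) => j1; case: (split p2) => j2 //= [].
      by move=> ->.
    move=> E1 E2; congr (rshift _ _); apply: e0_inj.
    by rewrite [LHS]surjective_pairing [RHS]surjective_pairing E2; congr (_, _);
      apply: val_inj; case: E1.
  rewrite exprS -e0_det -[in RHS](det_tr A) -(det_ublock A^T 0).
  congr (\det _).
  apply/matrixP=> q p.
  have splitl j : split (lshift (k * N) j) = inl j := unsplitK (inl j).
  have splitr j : split (rshift N j) = inr j := unsplitK (inr j).
  case: (@split_ordP N (k * N) q) => j1 ->;
    case: (@split_ordP N (k * N) p) => j2 ->;
    rewrite mxE ?(block_mxEul, block_mxEur, block_mxEdl, block_mxEdr);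
    by rewrite ?splitl ?splitr mxE /= ?mul0r ?mul1r.
move=> e_bij.
have d_eq : (#|L| * N = d)%N.
  by have := bij_eq_card e_bij; rewrite card_prod !card_ord.
move: e e_bij; rewrite -d_eq => e e_bij.
rewrite -e0_det.
pose e1 q := (enum_val (e0 q).1, (e0 q).2).
have e1_bij : bijective e1.
  apply: inj_card_bij; last by rewrite card_prod !card_ord.
  move=> q p [/enum_val_inj E1 E2]; apply: e0_inj.
  by rewrite [LHS]surjective_pairing [RHS]surjective_pairing E1 E2.
rewrite (det_reindex (fun x y : L * 'I_N => (x.1 == y.1)%:R * A y.2 x.2)
  e_bij e1_bij).
congr (\det _); apply/matrixP=> q p; rewrite !mxE /=.
by rewrite (inj_eq enum_val_inj).
Qed.

(** Multilinearity of the determinant in all rows at once. *)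
Lemma det_sum_rows (T : finType) d (M : 'I_d -> T -> 'I_d -> K)
    (c : 'I_d -> T -> K) :
  \sum_(y : {ffun 'I_d -> T})
     \det (\matrix_(r, p) M r (y r) p) * \prod_r c r (y r) =
  \det (\matrix_(r, p) \sum_j M r j p * c r j).
Proof.
under eq_bigr do rewrite mulr_suml.
rewrite exchange_big; apply: eq_bigr => s _ /=.
under [in RHS]eq_bigr do rewrite mxE.
rewrite bigA_distr_bigA mulr_sumr; apply: eq_bigr => y _ /=.
by rewrite -mulrA -big_split; congr (_ * _); apply: eq_bigr => r _; rewrite mxE.
Qed.

(** The substitution replaces the 0/1 matrix of the bracket by its product with
    (1 (x) A)^T, because the row of a position depends on the index at this
    position only. *)
Lemma pullback_bracket (L : finType) d N (e : 'I_d -> L * 'I_N)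
    (A : 'M[K]_N) V U :
  bijective e ->
  pullback (fun i j => A i j) (fun P => bracket K e (join V P)) U =
  \det A ^+ #|L| * bracket K e (join V U).
Proof.
move=> e_bij; rewrite -(det_block_copies A e_bij) mulrC -det_mulmx.
pose M r j p : K := ((V r, j) == e p)%:R.
rewrite [LHS](_ : _ = \sum_(y : {ffun 'I_d -> 'I_N})
   \det (\matrix_(r, p) M r (y r) p) * \prod_r A (y r) (U r)); last first.
  apply: eq_bigr => y _; congr (_ * _); congr (\det _).
  by apply/matrixP=> r p; rewrite !mxE ffunE.
rewrite (det_sum_rows M (fun r j => A j (U r))).
congr (\det _); apply/matrixP=> r p; rewrite !mxE.
have [f eK fK] := e_bij.
rewrite (bigD1 (f (V r, U r))) //= [X in _ + X]big1 => [|q qP]; last first.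
  rewrite !mxE ffunE; case: eqP => [Eq|]; last by rewrite mul0r.
  by case/eqP: qP; rewrite Eq eK.
rewrite !mxE ffunE fK eqxx mul1r addr0 /=.
rewrite (bigD1 (e p).2) //= [X in _ + X]big1 => [|j jP]; last first.
  rewrite /M; case: eqP => [Eq|]; last by rewrite mul0r.
  by case/eqP: jP; rewrite -Eq.
by rewrite addr0 /M -pair_eqE /pair_eq /= eqxx andbT.
Qed.

End Bracket.

(** * Polarization *)

Section Ryser.
Variable K : comPzRingType.

Lemma prod_indicator (I : finType) (P : pred I) :
  \prod_i (P i)%:R = [forall i, P i]%:R :> K.
Proof.
case: forallP => [PT|/forallP]; first by rewrite big1 // => i _; rewrite PT.
rewrite negb_forall => /existsP[i /negbTE Pi].
by rewrite (bigD1 i) //= Pi mul0r.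
Qed.

(** Ryser's formula for the permanent.  It serves to polarize: the left side
    involves only values of a product of linear forms at sums of vectors, the
    right side is its complete polarization.  A map f : [d] -> [d] contributes
    to the left side the alternating sum over the S that contain its image,
    and that sum vanishes unless f is onto. *)
Lemma ryser d (a : 'I_d -> 'I_d -> K) :
  \sum_(S : {ffun 'I_d -> bool})
     (\prod_s (-1) ^+ (~~ S s)) * \prod_r (\sum_s (S s)%:R * a r s) =
  \sum_(s : 'S_d) \prod_r a r (s r).
Proof.
under eq_bigr do rewrite bigA_distr_bigA mulr_sumr /=.
rewrite exchange_big /=.
rewrite (eq_bigr (fun f : {ffun 'I_d -> 'I_d} =>
    ([forall s, s \in codom f])%:R * \prod_r a r (f r))); last first.
  move=> f _; under eq_bigr do rewrite big_split /= mulrA.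
  rewrite -mulr_suml; congr (_ * _).
  rewrite (eq_bigr (fun S : {ffun 'I_d -> bool} =>
     \prod_s ((-1) ^+ (~~ S s) * ((s \in codom f) ==> S s)%:R))); last first.
    move=> S _; rewrite big_split /=; congr (_ * _).
    rewrite !prod_indicator; congr (_%:R); congr nat_of_bool.
    apply/forallP/forallP => [Sf s|Sf r].
      by apply/implyP=> /codomP[r ->].
    by have := Sf (f r); rewrite codom_f.
  rewrite -(bigA_distr_bigA (fun s b =>
     (-1) ^+ (~~ b) * ((s \in codom f) ==> b)%:R)) -prod_indicator.
  apply: eq_bigr => s _; rewrite big_bool /=.
  by case: (s \in codom f); rewrite /= ?(mulr1, mulr0, addr0, subrr).
rewrite (bigID (@injectiveb _ _ \o fun_of_fin)) /= [X in _ + X]big1 => [|f nf];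
    last first.
  case: forallP => [fT|]; last by rewrite mul0r.
  case/negP: nf; apply/injectiveP => r1 r2.
  apply: (@image_injP _ _ f predT _) => //; apply/eqP.
  by apply: eq_card => r; rewrite fT.
rewrite addr0 (reindex_onto (@pval _) (insubd (1%g : 'S_d))) => [|f f_inj];
  last first.
  by rewrite -[LHS]/(val _) val_insubd; move: f_inj => /= ->.
apply: eq_big => [s|s _].
  by rewrite /= (valKd _ s) eqxx andbT; case: s.
case: forallP => [_|nsurj]; last first.
  case: nsurj => r; apply/codomP; exists (s^-1%g r).
  by rewrite -[RHS]/(pval s (s^-1%g r)) pvalE permKV.
by rewrite mul1r; apply: eq_bigr => r _; rewrite -pvalE.
Qed.

End Ryser.

Section Polar.
Variables (K : comPzRingType) (d N : nat).

(** For a form chi of degree d, its complete polarization at the d elementary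
    matrices with entry 1 in position (P s, Q s). *)
Definition polar (chi : 'M[K]_N -> K) (P Q : {ffun 'I_d -> 'I_N}) : K :=
  \sum_(S : {ffun 'I_d -> bool}) (\prod_s (-1) ^+ (~~ S s)) *
    chi (\matrix_(i, j) \sum_s (S s)%:R * ((i == P s) && (j == Q s))%:R).

(** The hypothesis is an identity between polynomial functions of A, of degree d
    on the left; both sides are polarized. *)
Lemma polarized_invariance (chi : 'M[K]_N -> K) (h : {ffun 'I_d -> 'I_N} -> K) :
  (forall (A : 'M[K]_N) U, pullback (fun i j => A i j) h U = chi A * h U) ->
  forall P Q U : {ffun 'I_d -> 'I_N},
  \sum_(s : 'S_d) (U == permute Q s)%:R * h (permute P s) =
  polar chi P Q * h U.
Proof.
move=> h_inv P Q U; rewrite mulr_suml.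
under [RHS]eq_bigr do rewrite -mulrA -h_inv mulr_sumr.
rewrite exchange_big /=.
rewrite (eq_bigr (fun y : {ffun 'I_d -> 'I_N} => h y *
    \sum_(s : 'S_d) \prod_r ((y r == P (s r)) && (U r == Q (s r)))%:R));
    last first.
  move=> y _.
  rewrite -(ryser (fun r s => ((y r == P s) && (U r == Q s))%:R)) mulr_sumr.
  apply: eq_bigr => S _; rewrite mulrCA; congr (_ * (_ * _)).
  by apply: eq_bigr => r _; rewrite !mxE.
under [RHS]eq_bigr do rewrite mulr_sumr.
rewrite [RHS]exchange_big /=; apply: eq_bigr => s _.
rewrite (bigD1 (permute P s)) //= [X in _ + X]big1 => [|y yP]; last first.
  rewrite prod_indicator; case: forallP => [yPs|]; last by rewrite mulr0.
  by case/eqP: yP; apply/ffunP=> r; rewrite ffunE; case/andP: (yPs r) => /eqP.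
rewrite addr0 mulrC prod_indicator; congr (_ * _%:R); congr nat_of_bool.
apply/eqP/forallP => [-> r|Us]; first by rewrite !ffunE !eqxx.
by apply/ffunP=> r; rewrite ffunE; case/andP: (Us r) => _ /eqP.
Qed.

End Polar.

Section Forms.
Variables (K : numFieldType) (T : finType) (d : nat).
Implicit Types (f : {ffun 'I_d -> T} -> K) (t : T -> K).

Definition form f t : K := \sum_x f x * \prod_r t (x r).

Lemma form_linear g f t :
  form f (fun i => \sum_j g i j * t j) = form (pullback g f) t.
Proof.
rewrite /form /pullback; under eq_bigr do rewrite bigA_distr_bigA mulr_sumr.
rewrite exchange_big; apply: eq_bigr => y _ /=.
by rewrite mulr_suml; apply: eq_bigr => x _; rewrite -mulrA -big_split.
Qed.

Lemma fact_neq0 : (#|{: 'S_d}|%:R : K) != 0.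
Proof. by rewrite pnatr_eq0 -lt0n; apply/card_gt0P; exists 1%g. Qed.

(** Polarizing the form gives back d! times its coefficient tensor. *)
Lemma symmetric_form_eq0 f : (forall x s, f (permute x s) = f x) ->
  (forall t, form f t = 0) -> forall y, f y = 0.
Proof.
move=> f_sym f0 y.
have : \sum_(S : {ffun 'I_d -> bool}) (\prod_s (-1) ^+ (~~ S s)) *
    form f (fun i => \sum_s (S s)%:R * (i == y s)%:R) = 0.
  by apply: big1 => S _; rewrite f0 mulr0.
under eq_bigr do rewrite mulr_sumr.
rewrite exchange_big /=.
under eq_bigr => x _.
  under eq_bigr do rewrite mulrCA.
  rewrite -mulr_sumr (ryser (fun r s => (x r == y s)%:R)) mulr_sumr.
  over.
rewrite exchange_big /=.
rewrite (eq_bigr (fun=> f y)) => [|s _]; last first.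
  rewrite (bigD1 (permute y s)) //= [X in _ + X]big1 => [|x xP].
    rewrite f_sym big1 ?mulr1 ?addr0 // => r _.
    by rewrite ffunE eqxx.
  rewrite prod_indicator; case: forallP => [xy|]; last by rewrite mulr0.
  by case/eqP: xP; apply/ffunP=> r; rewrite ffunE (eqP (xy r)).
rewrite sumr_const -mulr_natl => /eqP; rewrite mulf_eq0 => /orP[|/eqP //].
by rewrite (negbTE fact_neq0).
Qed.

Definition form_poly f : {mpoly K[#|T|]} :=
  \sum_x f x *: \prod_r 'X_(enum_rank (x r)).

Lemma form_poly_eval f t : (form_poly f).@[fun i => t (enum_val i)] = form f t.
Proof.
rewrite raddf_sum; apply: eq_bigr => x _ /=; rewrite mevalZ rmorph_prod.
by congr (_ * _); apply: eq_bigr => r _; rewrite /= mevalXU enum_rankK.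
Qed.

Lemma form_poly_homog f : form_poly f \is d.-homog.
Proof.
apply: rpred_sum => x _; apply: dhomogZ.
have sum1 : (\sum_(r < d) 1)%N = d by rewrite sum1_card card_ord.
apply: (@eq_ind _ _ (fun k => \prod_r 'X_(enum_rank (x r)) \is k.-homog)
  _ _ sum1).
apply: (big_ind2 (fun (p : {mpoly K[_]}) k => p \is k.-homog))
  => [|p k q k'|r _].
- exact: dhomog1.
- exact: dhomogM.
by rewrite dhomogX; apply/eqP; exact: mdeg1.
Qed.

Lemma form_poly_permute f s :
  form_poly (fun x => f (permute x s)) = form_poly f.
Proof.
rewrite /form_poly [RHS](sum_permute s); apply: eq_bigr => x _; congr (_ *: _).
by rewrite (reindex_perm s) /=; apply: eq_bigr => r _; rewrite ffunE.
Qed.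

(** List the variables of the monomial with their multiplicities. *)
Lemma mpolyX_prod n (m : 'X_{1..n}) : mdeg m = d ->
  exists y : {ffun 'I_d -> 'I_n}, 'X_[K, m] = \prod_r 'X_(y r).
Proof.
pose s := flatten [seq nseq (m i) i | i <- enum 'I_n].
have size_s : size s = mdeg m.
  rewrite size_flatten /shape -map_comp mdegE sumnE big_map big_enum /=.
  by apply: eq_bigr => i _; rewrite size_nseq.
rewrite -size_s => dE; rewrite -dE.
exists [ffun r => tnth (in_tuple s) r].
rewrite mpolyXE_id; under [RHS]eq_bigr do rewrite ffunE.
rewrite -(big_tnth _ _ s xpredT (fun i => 'X_i)) big_flatten big_map big_enum /=.
by apply: eq_bigr => i _; rewrite big_nseq iter_mulr_1.
Qed.

(** Each monomial is a product of d variables; averaging the resulting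
    coefficients over the order of the factors makes them symmetric. *)
Lemma homog_form_poly (F : {mpoly K[#|T|]}) : F \is d.-homog ->
  exists2 f, forall x s, f (permute x s) = f x & F = form_poly f.
Proof.
move=> /dhomogP F_homog.
suff [f ->] : exists f, F = form_poly f.
  exists (fun x => #|{: 'S_d}|%:R^-1 * \sum_s f (permute x s)).
    move=> x s; congr (_ * _); rewrite [RHS](reindex_inj (mulIg s)) /=.
    by apply: eq_bigr => u _; rewrite permuteM.
  transitivity (#|{: 'S_d}|%:R^-1 *:
      \sum_(s : 'S_d) form_poly (fun x => f (permute x s))).
    under eq_bigr do rewrite form_poly_permute.
    by rewrite sumr_const -scaler_nat scalerA mulVf ?fact_neq0 ?scale1r.
  rewrite exchange_big scaler_sumr; apply: eq_bigr => x _ /=.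
  by rewrite -scaler_suml scalerA.
rewrite [F]mpolyE big_seq; apply: (big_ind (fun p => exists f, p = form_poly f)).
- by exists (fun=> 0); rewrite /form_poly big1 // => x _; rewrite scale0r.
- move=> _ _ [f ->] [g ->]; exists (fun x => f x + g x).
  by rewrite /form_poly -big_split; apply: eq_bigr => x _; rewrite scalerDl.
move=> m /F_homog /mpolyX_prod[y ->].
pose z : {ffun 'I_d -> T} := [ffun r => enum_val (y r)].
exists (fun x => F@_m * (x == z)%:R).
rewrite /form_poly (bigD1 z) //= [X in _ + X]big1 => [|x /negbTE xz].
  rewrite eqxx mulr1 addr0; congr (_ *: _); apply: eq_bigr => r _.
  by rewrite ffunE enum_valK.
by rewrite xz mulr0 scale0r.
Qed.

End Forms.

(** * Brackets detect invariants *)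

Section Separation.
Variables (K : numFieldType) (L : finType) (d N : nat).
Variable (e : 'I_d -> L * 'I_N).
Hypothesis e_bij : bijective e.

Let br V P := bracket K e (join V P).

Lemma bracket_real (T : finType) (f : 'I_d -> T) (z : {ffun 'I_d -> T}) :
  bracket K f z \is Num.real.
Proof.
rewrite rpred_sum // => s _; rewrite rpredM ?rpredX ?rpredN ?rpred1 //.
by rewrite rpred_prod // => r _; rewrite mxE realn.
Qed.

(** The dual form of the first fundamental theorem for SL_N.  Let c P be the
    polarization of det^k at the pair (P, U).  By [polarized_invariance], c P
    times h U is the sum of h (permute P s) over the stabilizer of U, and the
    same holds for brackets.  Taking P = U gives c U <> 0.  The relation for
    brackets says that c is a combination of brackets, so it is orthogonal to h
    and to its rearrangements; pairing c with the relation for h therefore shows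
    that h U times the sum of the (c P)^2 is 0. *)
Lemma bracket_separates (h : {ffun 'I_d -> 'I_N} -> K) :
  (forall (A : 'M[K]_N) U,
    pullback (fun i j => A i j) h U = \det A ^+ #|L| * h U) ->
  (forall V, \sum_P br V P * h P = 0) -> forall U, h U = 0.
Proof.
move=> h_inv h_orth U; apply/eqP/negPn/negP => hU_neq0.
set c := fun P => polar (fun A : 'M[K]_N => \det A ^+ #|L|) P U.
have stab_h P : \sum_(s : 'S_d | U == permute U s) h (permute P s) = c P * h U.
  rewrite -(polarized_invariance h_inv) big_mkcond; apply: eq_bigr => s _.
  by case: eqP; rewrite ?mul1r ?mul0r.
have stab_br V P W : \sum_(s : 'S_d | W == permute U s) br V (permute P s) =
    c P * br V W.
  rewrite -(polarized_invariance (fun A U => pullback_bracket A V U e_bij)).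
  rewrite big_mkcond; apply: eq_bigr => s _.
  by case: eqP; rewrite ?mul1r ?mul0r.
have cU_neq0 : c U != 0.
  have := stab_h U; rewrite (eq_bigr (fun _ => h U)) => [|s /eqP <- //].
  rewrite sumr_const -mulr_natl => /(mulIf hU_neq0) <-.
  rewrite pnatr_eq0 -lt0n; apply/card_gt0P; exists 1%g.
  by apply: (introT (@eqP _ U (permute U 1%g))); rewrite permute1.
pose V0 : {ffun 'I_d -> L} := [ffun r => (e r).1].
pose U0 : {ffun 'I_d -> 'I_N} := [ffun r => (e r).2].
have br0 : br V0 U0 = 1.
  rewrite -(bracket_id K (bij_inj e_bij)) /br; congr (bracket _ _ _).
  by apply/ffunP=> r; rewrite !ffunE -surjective_pairing.
(* As c U <> 0, the sum in stab_br at W = U0 cannot be empty.  So the index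
   map U is a rearrangement of U0, that is, takes each value #|L| times, and
   some bracket does not vanish at U. *)
have [t U0E] : exists t, U0 = permute U t.
  have [/existsP[t /eqP tP]|] := boolP [exists t, U0 == permute U t].
    by exists t.
  rewrite negb_exists => /forallP noperm.
  have := stab_br V0 U U0; rewrite br0 mulr1 big_pred0; last first.
    by move=> s; apply: negbTE.
  by move=> /esym/eqP; rewrite (negbTE cU_neq0).
pose V := permute V0 t^-1%g.
have brVU : br V U != 0.
  rewrite -[U](permuteK t) -U0E /br -permute_join bracket_permute -/(br _ _).
  by rewrite br0 mulr1 signr_eq0.
have c_real P : c P \is Num.real.
  have /(canRL (mulfK brVU)) -> := esym (stab_br V P U).
  rewrite rpred_div ?bracket_real //.
  by apply: rpred_sum => s _; exact: bracket_real.
have : \sum_P c P * (c P * h U) = 0.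
  under eq_bigr do rewrite -stab_h mulr_sumr.
  rewrite exchange_big big1 //= => s _.
  apply: (mulfI brVU); rewrite mulr0 mulr_sumr.
  under eq_bigr do rewrite mulrA [br V U * _]mulrC -stab_br mulr_suml.
  rewrite exchange_big big1 //= => s' _.
  rewrite (sum_permute s^-1%g).
  under eq_bigr do rewrite permuteKV.
  pose u := (s' * s^-1)%g.
  transitivity (\sum_P (-1) ^+ u * br (permute V u^-1%g) P * h P).
    apply: eq_bigr => P _; congr (_ * _).
    by rewrite /br -bracket_permute permute_join permuteKV permuteM.
  under eq_bigr do rewrite -mulrA.
  by rewrite -mulr_sumr h_orth mulr0.
under eq_bigr do rewrite mulrA.
rewrite -mulr_suml => /eqP; rewrite mulf_eq0 (negbTE hU_neq0) orbF.
rewrite psumr_eq0 => [/allP/(_ U)|P _]; last first.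
  by rewrite -expr2 real_exprn_even_ge0.
by rewrite mem_index_enum mulf_eq0 orbb (negbTE cU_neq0) => /(_ isT).
Qed.

End Separation.

(** * Invariants of the special linear group *)

(** With A = C (pid_mx r) R and r < N, conjugate diag (1, ..., 1, 2) by C. *)
Lemma singular_fixed (K : numFieldType) N (A : 'M[K]_N) :
  \det A = 0 -> exists2 G : 'M[K]_N, \det G = 2 & G *m A = A.
Proof.
case: N A => [|N] A; first by rewrite det_mx00 => /eqP; rewrite oner_eq0.
move=> detA; have rkA : (\rank A <= N)%N.
  rewrite -ltnS ltn_neqAle rank_leq_row andbT; apply/negP.
  by rewrite -[_ == _]/(row_free A) row_free_unit unitmxE unitfE detA eqxx.
pose D : 'M[K]_N.+1 := diag_mx (\row_j (if j == ord_max then 2 else 1)).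
exists (col_ebase A *m D *m invmx (col_ebase A)).
  have cA : \det (col_ebase A) != 0.
    by rewrite -unitfE -unitmxE col_ebase_unit.
  rewrite !det_mulmx det_inv mulrAC divff // mul1r det_diag big_ord_recr /=.
  rewrite big1 => [|i _]; rewrite !mxE ?eqxx ?mul1r //.
  by case: eqP => // /(congr1 val) /= iN; have := ltn_ord i; rewrite iN ltnn.
rewrite -[X in _ *m X = _]mulmx_ebase -!mulmxA mulKmx ?col_ebase_unit //.
rewrite (mulmxA D) (_ : D *m _ = pid_mx (\rank A)) ?mulmxA ?mulmx_ebase //.
rewrite mul_diag_mx; apply/matrixP=> i j; rewrite !mxE.
case: (i == j :> nat); rewrite ?mulr0 //=; case: ltnP => ir; rewrite ?mulr0 //.
case: eqP ir => [->|_]; last by rewrite mulr1.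
by rewrite ltnNge rkA.
Qed.

Section SpecialLinear.
Variables (K : numClosedFieldType) (d N : nat) (h : {ffun 'I_d -> 'I_N} -> K).
Hypotheses (d_gt0 : (0 < d)%N) (N_gt0 : (0 < N)%N).
Hypothesis h_inv : forall A : 'M[K]_N, \det A = 1 ->
  forall U, pullback (fun i j => A i j) h U = h U.

(** The scalar matrix a, which multiplies h by a^d, reduces A to a matrix of
    determinant 1. *)
Lemma pullback_det_power (a : K) (A : 'M[K]_N) U : a != 0 -> \det A = a ^+ N ->
  pullback (fun i j => A i j) h U = a ^+ d * h U.
Proof.
move=> a_neq0 detA; rewrite -(h_inv (A := a^-1 *: A)) -?pullback_scale.
  by apply: eq_pullback => i j; rewrite mxE mulVKf.
by rewrite detZ detA exprVn mulVf // expf_neq0.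
Qed.

(** The matrix diag (2^N, 1, ..., 1) multiplies h U by a power of 2^N, and by
    2^d according to [pullback_det_power] with a = 2. *)
Lemma SL_dvd U : h U != 0 -> (N %| d)%N.
Proof.
move=> hU; pose i0 := Ordinal N_gt0.
pose w i : K := if i == i0 then 2 ^+ N else 1.
have detD : \det (diag_mx (\row_i w i)) = 2 ^+ N.
  rewrite det_diag (bigD1 i0) //= big1 => [|i /negbTE ii0].
    by rewrite mxE /w eqxx mulr1.
  by rewrite mxE /w ii0.
have two_neq0 : (2 : K) != 0 by rewrite pnatr_eq0.
have := pullback_det_power U two_neq0 detD.
rewrite (eq_pullback (g2 := fun i j => w i *+ (i == j))) => [|i j]; last first.
  by rewrite !mxE.
rewrite pullback_diag mulrC => /(mulIf hU).
rewrite -big_mkcond prodr_const -exprM -!natrX => /eqP.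
rewrite eqr_nat eqn_exp2l // => /eqP <-.
exact: dvdn_mulr.
Qed.

(** An invertible A is reduced to determinant 1 by an N-th root of its
    determinant.  For singular A, take G as in [singular_fixed]: from G A = A
    the substitution of A in h equals 2^(d / N) times itself, so it is 0. *)
Lemma pullback_SL U0 : h U0 != 0 -> forall (A : 'M[K]_N) U,
  pullback (fun i j => A i j) h U = \det A ^+ (d %/ N) * h U.
Proof.
move=> hU0; have Nd := SL_dvd hU0.
have inv_case A U : \det A != 0 ->
    pullback (fun i j => A i j) h U = \det A ^+ (d %/ N) * h U.
  move=> detA; pose a := N.-root (\det A).
  have aN : \det A = a ^+ N by rewrite rootCK.
  have a_neq0 : a != 0.
    by apply: contraNneq detA; rewrite aN => ->; rewrite expr0n eqn0Ngt N_gt0.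
  by rewrite (pullback_det_power _ a_neq0 aN) aN -exprM mulnC divnK.
move=> A U; have [detA|] := eqVneq (\det A) 0; last exact: inv_case.
have k_gt0 : (0 < d %/ N)%N by rewrite divn_gt0 // dvdn_leq.
have [G detG GA] := singular_fixed detA.
have := pullback_pullback (fun i j => G i j) (fun i j => A i j) h U.
rewrite [RHS](eq_pullback (g2 := fun i j => A i j)) => [|i j]; last first.
  by rewrite -[in RHS]GA mxE.
rewrite [LHS](_ : _ = 2 ^+ (d %/ N) * pullback (fun i j => A i j) h U);
  last first.
  rewrite mulr_sumr; apply: eq_bigr => y _.
  by rewrite inv_case detG ?pnatr_eq0 // mulrA.
rewrite detA expr0n eqn0Ngt k_gt0 mul0r => /eqP.
rewrite -subr_eq0 -[X in _ - X]mul1r -mulrBl mulf_eq0 => /orP[|/eqP //].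
rewrite subr_eq0 -natrX (eqr_nat _ _ 1) -[X in _ == X](expn0 2) eqn_exp2l //.
by move=> k0; rewrite (eqP k0) in k_gt0.
Qed.

Lemma SL_bracket_pairing U0 : h U0 != 0 ->
  exists k, d = (k * N)%N /\
  exists (e : 'I_d -> 'I_k * 'I_N) (V : {ffun 'I_d -> 'I_k}),
    \sum_P bracket K e (join V P) * h P != 0.
Proof.
move=> hU0; have Nd := SL_dvd hU0; exists (d %/ N)%N.
rewrite divnK //; split=> //.
have [|e e_bij] := @bij_of_card ('I_(d %/ N) * 'I_N)%type d.
  by rewrite card_prod !card_ord divnK.
exists e.
have [V VP|noV] := pickP (fun V => \sum_P bracket K e (join V P) * h P != 0).
  by exists V.
case/eqP: (hU0); apply: (bracket_separates e_bij) => [A U|V].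
  by rewrite card_ord (pullback_SL hU0).
by apply/eqP; rewrite -[_ == _]negbK noV.
Qed.

End SpecialLinear.

(** * The lower bound *)

Section LowerBound.
Variables (K : numClosedFieldType) (a b c d : nat).
Variable f : {ffun 'I_d -> 'I_a * 'I_b * 'I_c} -> K.
Hypotheses (a_gt0 : (0 < a)%N) (b_gt0 : (0 < b)%N) (c_gt0 : (0 < c)%N).
Hypothesis d_gt0 : (0 < d)%N.
Hypothesis f_sym : forall x s, f (permute x s) = f x.
Hypothesis f_inv : forall (A : 'M[K]_a) (B : 'M[K]_b) (C : 'M[K]_c),
  \det A = 1 -> \det B = 1 -> \det C = 1 -> forall x,
  pullback (kron3 A B C) f x = f x.

(** Pair f with a bracket in each argument, keeping the value nonzero.  Two
    positions with equal labels in all three brackets would make the pairing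
    change by (-1)^3 under their exchange; so the k1 k2 k3 triples of labels
    are at least as many as the positions, where d = k1 a = k2 b = k3 c. *)
Lemma invariant_degree_bound x0 : f x0 != 0 -> (a * b * c <= d ^ 2)%N.
Proof.
rewrite -[x0]joinK -[lpart x0]joinK.
move: (lpart (lpart x0)) (rpart (lpart x0)) (rpart x0) => I0 J0 K0 f0.
have [|k1 [d1 [e1 [V1]]]] := @SL_bracket_pairing _ _ _
    (fun I => f (join (join I J0) K0)) d_gt0 a_gt0 _ _ f0.
  move=> A detA I; rewrite -[RHS](f_inv detA (det1 _ _) (det1 _ _)).
  rewrite /kron3 !pullback_kron.
  by apply: eq_pullback_tensor => I'; rewrite !pullback_one.
set f1 := fun J K => \sum_I bracket _ e1 (join V1 I) * f (join (join I J) K).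
rewrite -/(f1 J0 K0) => f10.
have [|k2 [d2 [e2 [V2]]]] := @SL_bracket_pairing _ _ _
    (f1^~ K0) d_gt0 b_gt0 _ _ f10.
  move=> B detB J; rewrite pullback_sum; apply: eq_bigr => I _.
  rewrite pullback_mull; congr (_ * _).
  rewrite -[RHS](f_inv (det1 _ _) detB (det1 _ _)) /kron3 !pullback_kron.
  by rewrite pullback_one; apply: eq_pullback_tensor => J'; rewrite !pullback_one.
set f2 := fun K => \sum_J bracket _ e2 (join V2 J) * f1 J K.
rewrite -/(f2 K0) => f20.
have [|k3 [d3 [e3 [V3]]]] := @SL_bracket_pairing _ _ _ f2 d_gt0 c_gt0 _ _ f20.
  move=> C detC k; rewrite pullback_sum; apply: eq_bigr => J _.
  rewrite pullback_mull; congr (_ * _).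
  rewrite pullback_sum; apply: eq_bigr => I _.
  rewrite pullback_mull; congr (_ * _).
  rewrite -[RHS](f_inv (det1 _ _) (det1 _ _) detC) /kron3 !pullback_kron.
  by rewrite !pullback_one.
set total := \sum_K _ => total_neq0.
have V_inj : injective (fun r => (V1 r, V2 r, V3 r)).
  move=> r1 r2 [V1r V2r V3r]; apply/eqP/negPn/negP => r12.
  case/eqP: total_neq0; pose t := tperm r1 r2.
  have fix_t (T : finType) (V : {ffun 'I_d -> T}) :
      V r1 = V r2 -> permute V t = V.
    move=> Vr; apply/ffunP=> r; rewrite ffunE /t.
    by case: tpermP => [->|->|].
  have br_t (T : finType) N (e : 'I_d -> T * 'I_N) (V : {ffun 'I_d -> T})
      (I : {ffun 'I_d -> 'I_N}) : V r1 = V r2 ->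
      bracket K e (join V (permute I t)) = - bracket K e (join V I).
    move=> Vr; rewrite -[V in LHS](fix_t _ _ Vr) -permute_join bracket_permute.
    by rewrite odd_tperm r12 mulN1r.
  suff tN : total = - total.
    by apply/eqP; move/eqP: tN; rewrite -addr_eq0 -mulr2n mulrn_eq0.
  rewrite {1}/total (sum_permute t).
  under eq_bigr => k _.
    rewrite br_t // /f2 (sum_permute t).
    under eq_bigr => J _.
      rewrite br_t // /f1 (sum_permute t).
      under eq_bigr => I _ do rewrite br_t // -!permute_join f_sym mulNr.
      rewrite sumrN mulrNN -/(f1 J k).
      over.
    rewrite -/(f2 k) mulNr.
    over.
  by rewrite sumrN.
have := leq_card _ V_inj; rewrite !card_prod !card_ord => d_le.
rewrite -(leq_pmul2l d_gt0) -expnS.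
have -> : (d ^ 3 = k1 * k2 * k3 * (a * b * c))%N.
  have -> : (d ^ 3 = (k1 * a) * (k2 * b) * (k3 * c))%N.
    by rewrite -d1 -d2 -d3 -mulnA.
  by lia.
by rewrite leq_mul2r d_le orbT.
Qed.

End LowerBound.

(** * The invariant of degree lmn *)

Section Existence.
Variables (K : numFieldType).

(** Brackets treat labels and indices alike, so that [bracket_separates] also
    applies to invariant functions of the labels. *)
Lemma dual_bracket_separates d p N (e : 'I_d -> 'I_p * 'I_N)
    (h : {ffun 'I_d -> 'I_p} -> K) : bijective e ->
  (forall (A : 'M[K]_p) U,
    pullback (fun i j => A i j) h U = \det A ^+ N * h U) ->
  (forall I, \sum_U bracket K e (join U I) * h U = 0) -> forall U, h U = 0.
Proof.
move=> e_bij h_inv h_orth.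
pose swap (x : 'I_p * 'I_N) := (x.2, x.1).
have swap_bij : bijective swap by exists (fun x => (x.2, x.1)) => [[]|[]].
apply: (bracket_separates (bij_comp swap_bij e_bij)) => [A U|I].
  by rewrite card_ord h_inv.
rewrite -[RHS](h_orth I); apply: eq_bigr => U _; congr (_ * _).
rewrite -(bracket_comp K e (join U I) (bij_inj swap_bij)).
by congr (bracket _ _ _); apply/ffunP=> r; rewrite !ffunE.
Qed.

Variables (l m n d : nat).

Variables (e0 : 'I_d -> 'I_n * 'I_l * 'I_m).
Variables (eA : 'I_d -> 'I_n * 'I_(l * m)) (eB : 'I_d -> 'I_l * 'I_(m * n)).
Variables (eC : 'I_d -> 'I_m * 'I_(n * l)).
Hypotheses (e0_bij : bijective e0) (eA_bij : bijective eA).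
Hypotheses (eB_bij : bijective eB) (eC_bij : bijective eC).

(** Here [n] x [l] x [m] is the cube of the triples (u, v, w), and a position is
    sent to the triple of its three labels.  The first bracket is the sign of
    this map when it is a bijection, and 0 otherwise. *)
Definition cube_tensor
    (x : {ffun 'I_d -> 'I_(l * m) * 'I_(m * n) * 'I_(n * l)}) : K :=
  \sum_U \sum_V \sum_W bracket K e0 (join (join U V) W) *
    bracket K eA (join U (lpart (lpart x))) *
    bracket K eB (join V (rpart (lpart x))) *
    bracket K eC (join W (rpart x)).

(** Rearranging the positions changes the sign of all four brackets. *)
Lemma cube_tensor_symmetric x s : cube_tensor (permute x s) = cube_tensor x.
Proof.
apply: etrans (@sum_permute 'I_n d K s _) _; apply: eq_bigr => U _.
apply: etrans (@sum_permute 'I_l d K s _) _; apply: eq_bigr => V _.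
apply: etrans (@sum_permute 'I_m d K s _) _; apply: eq_bigr => W _.
rewrite !(lpart_permute, rpart_permute) -!permute_join !bracket_permute.
have sgn2 : (-1) ^+ s * (-1) ^+ s = 1 :> K by rewrite -signr_addb addbb.
move: ((-1) ^+ s) sgn2 (bracket _ _ _) (bracket _ _ _) (bracket _ _ _)
  (bracket _ _ _) => sg sgn2 b0 b1 b2 b3.
rewrite (_ : _ * _ = (sg * sg) * (sg * sg) * (b3 * b2 * b1 * b0)); last by ring.
by rewrite sgn2 !mul1r.
Qed.

Lemma cube_tensor_invariant (A : 'M[K]_(l * m)) (B : 'M[K]_(m * n))
    (C : 'M[K]_(n * l)) : \det A = 1 -> \det B = 1 -> \det C = 1 -> forall x,
  pullback (kron3 A B C) cube_tensor x = cube_tensor x.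
Proof.
move=> detA detB detC x; rewrite -[x]joinK -[lpart x]joinK.
move: (lpart (lpart x)) (rpart (lpart x)) (rpart x) => I J k.
rewrite !pullback_sum /cube_tensor; apply: eq_bigr => U _.
rewrite !pullback_sum; apply: eq_bigr => V _.
rewrite !pullback_sum; apply: eq_bigr => W _.
rewrite !(lpart_join, rpart_join) /kron3 !pullback_kron.
under eq_pullback_tensor => I'.
  under eq_pullback_tensor => J'.
    under eq_pullback_tensor => k' do rewrite !(lpart_join, rpart_join).
    rewrite pullback_mull (pullback_bracket C W k eC_bij) detC expr1n mul1r.
    over.
  rewrite pullback_mulr pullback_mull (pullback_bracket B V J eB_bij).
  rewrite detB expr1n mul1r.
  over.
rewrite !pullback_mulr pullback_mull (pullback_bracket A U I eA_bij).
by rewrite detA expr1n mul1r.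
Qed.

(** A bracket whose values lie in a product of several sets is invariant in each
    factor: f regroups the product so that this factor becomes the index and
    the others, held fixed in V, the label. *)
Lemma bracket_slot (T : finType) p (e1 : 'I_d -> T) (L : finType)
    (V : {ffun 'I_d -> L}) (f : T -> L * 'I_p)
    (g : {ffun 'I_d -> 'I_p} -> {ffun 'I_d -> T}) (A : 'M[K]_p)
    (U : {ffun 'I_d -> 'I_p}) :
  bijective e1 -> bijective f ->
  (forall U, join V U = [ffun r => f (g U r)]) ->
  pullback (fun i j => A i j) (fun U => bracket K e1 (g U)) U =
  \det A ^+ #|L| * bracket K e1 (g U).
Proof.
move=> e1_bij f_bij gV.
have slotE W : bracket K e1 (g W) = bracket K (f \o e1) (join V W).
  by rewrite gV bracket_comp //; exact: bij_inj.
rewrite slotE -(pullback_bracket A V U (bij_comp f_bij e1_bij)).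
by apply: eq_pullback_tensor => W; rewrite slotE.
Qed.

(** The value at (I, J, k) is an iterated sum against brackets: over U with I,
    over V with J, over W with k.  What is summed against the bracket of I is an
    invariant function of U, because the first bracket is one, with exponent
    l * m, the size of the product of the other two sides of the cube; this is
    also the number of values of an index of I.  So if the tensor vanishes,
    [dual_bracket_separates] strips off the bracket of I, then likewise those of
    J and k, and the sign of every identification of the positions with the
    cube would be 0. *)
Lemma cube_tensor_neq0 : exists x, cube_tensor x != 0.
Proof.
have [x fx|f_eq0] := pickP (fun x => cube_tensor x != 0); first by exists x.
suff br_eq0 U V W : bracket K e0 (join (join U V) W) = 0.
  have /eqP := bracket_id K (bij_inj e0_bij).
  by rewrite -[finfun e0]joinK -[lpart _]joinK br_eq0 eq_sym oner_eq0.
move: W; apply: (dual_bracket_separates eC_bij) => [A W|k].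
  rewrite (@bracket_slot _ _ _ _ (join U V) id) //; last first.
  - by move=> W'; apply/ffunP=> r; rewrite !ffunE.
  - by exists id.
  by rewrite card_prod !card_ord.
move: V; apply: (dual_bracket_separates eB_bij) => [A V|J].
  rewrite pullback_sum mulr_sumr; apply: eq_bigr => W _.
  rewrite pullback_mull [RHS]mulrCA; congr (_ * _).
  rewrite (@bracket_slot _ _ _ _ (join U W) (fun x => (x.1.1, x.2, x.1.2))
      (fun V => join (join U V) W)) //; last first.
  - by move=> V'; apply/ffunP=> r; rewrite !ffunE.
  - by exists (fun x => (x.1.1, x.2, x.1.2)) => [[[]]|[[]]].
  by rewrite card_prod !card_ord mulnC.
move: U; apply: (dual_bracket_separates eA_bij) => [A U|I].
  rewrite pullback_sum mulr_sumr; apply: eq_bigr => V _.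
  rewrite pullback_mull [RHS]mulrCA; congr (_ * _).
  rewrite pullback_sum mulr_sumr; apply: eq_bigr => W _.
  rewrite pullback_mull [RHS]mulrCA; congr (_ * _).
  rewrite (@bracket_slot _ _ _ _ (join V W) (fun x => (x.1.2, x.2, x.1.1))
      (fun U => join (join U V) W)) //; last first.
  - by move=> U'; apply/ffunP=> r; rewrite !ffunE.
  - by exists (fun x => (x.2, x.1.1, x.1.2)) => [[[]]|[[]]].
  by rewrite card_prod !card_ord.
transitivity (cube_tensor (join (join I J) k)); last first.
  by apply/eqP; rewrite -[_ == _]negbK f_eq0.
apply: eq_bigr => U _; rewrite mulr_sumr; apply: eq_bigr => V _.
rewrite !mulr_sumr; apply: eq_bigr => W _.
rewrite !(lpart_join, rpart_join).
by move: (bracket _ _ _) (bracket _ _ _) (bracket _ _ _) (bracket _ _ _) =>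
  *; ring.
Qed.

End Existence.

(** * Invariant tensors and invariant polynomials *)

Section Invariants.
Variables (K : numFieldType) (a b c d : nat).

Lemma form_act (f : {ffun 'I_d -> 'I_a * 'I_b * 'I_c} -> K) A B C t :
  form f (tensor_act A B C t) = form (pullback (kron3 A B C) f) t.
Proof.
rewrite -form_linear; apply: eq_bigr => x _; congr (_ * _).
apply: eq_bigr => r _; rewrite ffunE.
by rewrite pair_bigA pair_bigA; apply: eq_bigr => -[[i j] k] _.
Qed.

(** The tensor pullback (kron3 A B C) f - f is symmetric, so it vanishes when its
    form does. *)
Lemma SL_invariant_form_poly (f : {ffun 'I_d -> 'I_a * 'I_b * 'I_c} -> K) :
  (forall x s, f (permute x s) = f x) ->
  SL_invariant (form_poly f) <->
  forall A B C, \det A = 1 -> \det B = 1 -> \det C = 1 ->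
    forall x, pullback (kron3 A B C) f x = f x.
Proof.
move=> f_sym; split=> f_inv A B C detA detB detC; last first.
  move=> t; rewrite /tensor_eval !form_poly_eval form_act.
  by apply: eq_bigr => x _; rewrite f_inv.
move=> x; apply/eqP; rewrite -subr_eq0; apply/eqP; move: x.
apply: symmetric_form_eq0 => [x s|t].
  by rewrite pullback_symmetric // f_sym.
have := f_inv A B C detA detB detC (finfun t).
rewrite /tensor_eval !form_poly_eval form_act => /eqP.
rewrite -subr_eq0 => /eqP.
rewrite /form -sumrB => E; rewrite -[RHS]E; apply: eq_bigr => x _.
by rewrite -mulrBl; congr (_ * _); apply: eq_bigr => r _; rewrite ffunE.
Qed.

End Invariants.

Theorem proposition4p1 (R : realType) (l m n : nat)
    (hl : (0 < l)%N) (hm : (0 < m)%N) (hn : (0 < n)%N) :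
  (exists F : tensor_poly R[i] (l * m) (m * n) (n * l),
      nonzero_invariant_of_degree (l * m * n) F) /\
  (forall (d : nat) (F : tensor_poly R[i] (l * m) (m * n) (n * l)),
      (0 < d)%N -> nonzero_invariant_of_degree d F -> (l * m * n <= d)%N).
Proof.
split=> [|d F d_gt0 [F_neq0 /homog_form_poly[f f_sym FE] F_inv]]; last first.
  have f_inv := (SL_invariant_form_poly f_sym).1.
  rewrite -FE in f_inv.
  have [x fx|f_eq0] := pickP (fun x => f x != 0); last first.
    case/eqP: F_neq0; rewrite FE; apply: big1 => x _.
    by move/negbFE/eqP: (f_eq0 x) => ->; rewrite scale0r.
  have := invariant_degree_bound _ _ _ d_gt0 f_sym (f_inv F_inv) fx.
  rewrite !muln_gt0 hl hm hn => /(_ isT isT isT).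
  have -> : (l * m * (m * n) * (n * l) = (l * m * n) ^ 2)%N.
    by rewrite -mulnn; lia.
  by rewrite leq_exp2r.
have [e0 e0_bij] : exists e : 'I_(l * m * n) -> 'I_n * 'I_l * 'I_m, bijective e.
  by apply: bij_of_card; rewrite !card_prod !card_ord; lia.
have [eA eA_bij] : exists e : 'I_(l * m * n) -> 'I_n * 'I_(l * m), bijective e.
  by apply: bij_of_card; rewrite !card_prod !card_ord; lia.
have [eB eB_bij] : exists e : 'I_(l * m * n) -> 'I_l * 'I_(m * n), bijective e.
  by apply: bij_of_card; rewrite !card_prod !card_ord; lia.
have [eC eC_bij] : exists e : 'I_(l * m * n) -> 'I_m * 'I_(n * l), bijective e.
  by apply: bij_of_card; rewrite !card_prod !card_ord; lia.
pose f := @cube_tensor R[i] _ _ _ _ e0 eA eB eC.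
have f_sym : forall x s, f (permute x s) = f x.
  by move=> x s; exact: cube_tensor_symmetric.
exists (form_poly f); split; last first.
- apply/(SL_invariant_form_poly f_sym) => A B C detA detB detC x.
  exact: cube_tensor_invariant.
- exact: form_poly_homog.
have [x] := cube_tensor_neq0 R[i] e0_bij eA_bij eB_bij eC_bij.
apply: contra_neq => f0; apply: (symmetric_form_eq0 f_sym) => t.
by rewrite -form_poly_eval f0 meval0.
Qed.
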